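(* $\Sigma_\pi$ is the closure of its interior (interior and closure taken in $\mathbb{C}$).
   Context: For $c\in\{\pm1\}^{\mathbb{Z}}$ let $A_c$ be the bounded operator on $\ell^2(\mathbb{Z})$ given by $(A_c\phi)_m=c_m\phi_{m-1}+\phi_{m+1}$, $m\in\mathbb{Z}$. $\pi_\infty$ is the union of the spectra (on $\ell^2(\mathbb{Z})$) of $A_c$ over all periodic $c\in\{\pm1\}^{\mathbb{Z}}$, and $\Sigma_\pi:=\overline{\pi_\infty}\subset\mathbb{C}$. *)

(* Defs.v *)
From HB Require Import structures.
From mathcomp Require Import all_boot all_order all_algebra.
From mathcomp Require Import complex.
From mathcomp Require Import all_classical all_reals all_analysis.
From mathcomp Require Import ring lra.

Set Implicit Arguments.
Unset Strict Implicit.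
Unset Printing Implicit Defensive.

Import Order.TTheory GRing.Theory Num.Theory.
Import numFieldNormedType.Exports.

Local Open Scope classical_set_scope.
Local Open Scope ring_scope.
Local Open Scope complex_scope.

(* [Normc.normc] is the modulus on [R[i]] with values in [R]; the library norm
   [`|z|] on [R[i]] takes values in [R[i]]. *)
Section square_sum.
Context {R : realType}.
Implicit Types (u v : int -> R[i]) (a : int -> \bar R).

Definition sqr_sum u : \bar R :=
  \esum_(m in [set: int]) ((Normc.normc (u m)) ^+ 2)%:E.

Definition square_summable : {pred int -> R[i]} :=
  fun u => summable [set: int] (fun m => ((Normc.normc (u m)) ^+ 2)%:E).

Lemma sqr_sum_ge0 u : (0 <= sqr_sum u)%E.
Proof. by apply: esum_ge0 => m _; rewrite lee_fin sqr_ge0. Qed.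

Lemma square_summableE u : (u \in square_summable) = (sqr_sum u < +oo)%E.
Proof.
rewrite unfold_in /square_summable /summable /sqr_sum; congr (_ < _)%E.
by apply: eq_esum => m _; rewrite gee0_abs// lee_fin sqr_ge0.
Qed.

Lemma square_summable_fin u : u \in square_summable ->
  sqr_sum u = (fine (sqr_sum u))%:E.
Proof.
by rewrite square_summableE => hu; rewrite fineK// ge0_fin_numE// sqr_sum_ge0.
Qed.

Lemma esum_scale (r : R) a : 0 <= r -> (forall m, 0 <= a m)%E ->
  (\esum_(m in [set: int]) (r%:E * a m) =
   r%:E * \esum_(m in [set: int]) a m)%E.
Proof.
move=> r0 a0; rewrite /esum -ereal_supZl//; last first.
  by apply/set0P; exists 0%E; exists set0; [exact: fsets_set0|rewrite fsbig_set0].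
congr (ereal_sup _); rewrite image_comp; apply: eq_imagel => A _ /=.
by rewrite ge0_mule_fsumr.
Qed.

Lemma sqr_sumD u v (t : R) : 0 < t ->
  (sqr_sum (u + v)%R <=
   (1 + t)%:E * sqr_sum u + (1 + t^-1)%:E * sqr_sum v)%E.
Proof.
move=> t0; have ti0 : 0 < t^-1 by rewrite invr_gt0.
rewrite /sqr_sum -!esum_scale; try by [|move=> m; rewrite lee_fin sqr_ge0];
  try by rewrite addr_ge0// ltW.
rewrite -esumD; last first.
- by move=> m _; rewrite -EFinM lee_fin mulr_ge0 ?sqr_ge0// addr_ge0// ltW.
- by move=> m _; rewrite -EFinM lee_fin mulr_ge0 ?sqr_ge0// addr_ge0// ltW.
apply: le_esum => m _; rewrite -!EFinM -EFinD lee_fin.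
set x := Normc.normc (u m); set y := Normc.normc (v m).
have n0 (z : R[i]) : 0 <= Normc.normc z by case: z => ? ?; exact: sqrtr_ge0.
apply: (@le_trans _ _ ((x + y) ^+ 2)).
  by rewrite ler_sqr ?nnegrE ?addr_ge0 ?n0//; exact: le_normcD.
have -> : (1 + t) * x ^+ 2 + (1 + t^-1) * y ^+ 2 =
    (x + y) ^+ 2 + t^-1 * (t * x - y) ^+ 2.
  by field; rewrite gt_eqF.
by rewrite lerDl mulr_ge0 ?sqr_ge0// ltW.
Qed.

Lemma sqr_sumZ (k : R[i]) u :
  sqr_sum (k *: u) = (((Normc.normc k) ^+ 2)%:E * sqr_sum u)%E.
Proof.
rewrite /sqr_sum -esum_scale ?sqr_ge0//; last first.
  by move=> m; rewrite lee_fin sqr_ge0.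
by apply: eq_esum => m _; rewrite -EFinM Normc.normcM exprMn.
Qed.

Lemma sqr_sum0 : sqr_sum 0 = 0%E.
Proof. by apply: esum1 => m _; rewrite Normc.normc0 expr0n. Qed.

Lemma sqr_sum_eq0 u : sqr_sum u = 0%E -> u = 0.
Proof.
move=> u0; apply/funext => m; apply: Normc.eq0_normc; apply/eqP.
rewrite -sqrf_eq0 eq_le sqr_ge0 andbT -lee_fin.
apply: (@le_trans _ _ (sqr_sum u)); last by rewrite u0.
apply: esum_ge; exists [set m]; first by split.
by rewrite fsbig_set1.
Qed.

Lemma sqr_sum_bij (e : int -> int) u : bijective e ->
  sqr_sum (u \o e) = sqr_sum u.
Proof.
move=> be; rewrite /sqr_sum [RHS](@reindex_esum _ _ _ [set: int] [set: int] e)//.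
by rewrite setTT_bijective.
Qed.

Fact square_summable_submod_closed : submod_closed square_summable.
Proof.
split=> [|k u v]; rewrite !square_summableE ?sqr_sum0 ?ltry// => hu hv.
apply: le_lt_trans (sqr_sumD _ _ ltr01) _; rewrite sqr_sumZ.
move: hu hv; rewrite -!square_summableE => hu hv.
by rewrite (square_summable_fin hu) (square_summable_fin hv) ltry.
Qed.

HB.instance Definition _ := GRing.isSubmodClosed.Build R[i] (int -> R[i])
  square_summable square_summable_submod_closed.

End square_sum.

Record ell2 (R : realType) := Ell2 {
  ell2_fun :> int -> R[i];
  ell2_mem : ell2_fun \in square_summable }.

Section ell2_normed_module.
Variable R : realType.
Local Notation ell2 := (ell2 R).
Implicit Types phi psi : ell2.

HB.instance Definition _ := [isSub for @ell2_fun R].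
HB.instance Definition _ := [Choice of ell2 by <:].
HB.instance Definition _ := [SubChoice_isSubLmodule of ell2 by <:].

Definition ell2_rnorm phi : R := Num.sqrt (fine (sqr_sum phi)).

Lemma sqr_ell2_rnorm phi : sqr_sum phi = (ell2_rnorm phi ^+ 2)%:E.
Proof.
rewrite sqr_sqrtr; first exact/square_summable_fin/ell2_mem.
by rewrite fine_ge0// sqr_sum_ge0.
Qed.

Lemma ell2_rnorm_ge0 phi : 0 <= ell2_rnorm phi.
Proof. exact: sqrtr_ge0. Qed.

Lemma ell2_rnorm_eq0 phi : ell2_rnorm phi = 0 -> phi = 0.
Proof.
move=> h; apply: val_inj; apply: sqr_sum_eq0.
by rewrite [LHS]sqr_ell2_rnorm h expr0n.
Qed.

Lemma ell2_rnormD phi psi :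
  ell2_rnorm (phi + psi) <= ell2_rnorm phi + ell2_rnorm psi.
Proof.
have := ell2_rnorm_ge0 phi; rewrite le_eqVlt => /predU1P[/esym h|a0].
  by rewrite h (ell2_rnorm_eq0 h) !add0r.
have := ell2_rnorm_ge0 psi; rewrite le_eqVlt => /predU1P[/esym h|b0].
  by rewrite h (ell2_rnorm_eq0 h) !addr0.
have := sqr_sumD phi psi (divr_gt0 b0 a0).
have -> : (ell2_fun phi + ell2_fun psi) = ell2_fun (phi + psi) by [].
rewrite !sqr_ell2_rnorm -!EFinM -EFinD lee_fin => h.
rewrite -ler_sqr ?nnegrE ?addr_ge0 ?ell2_rnorm_ge0//.
apply: le_trans h _; rewrite le_eqVlt; apply/orP; left; apply/eqP.
by field; rewrite !gt_eqF.
Qed.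

Lemma ell2_rnormZ (k : R[i]) phi :
  ell2_rnorm (k *: phi) = Normc.normc k * ell2_rnorm phi.
Proof.
have k0 : 0 <= Normc.normc k by case: (k) => ? ?; exact: sqrtr_ge0.
apply/eqP; rewrite -(@eqrXn2 _ 2) ?mulr_ge0 ?ell2_rnorm_ge0// exprMn.
by rewrite -eqe [X in _ == X]EFinM -!sqr_ell2_rnorm -sqr_sumZ.
Qed.

Definition ell2_norm phi : R[i] := (ell2_rnorm phi)%:C.

Fact ell2_normD phi psi : ell2_norm (phi + psi) <= ell2_norm phi + ell2_norm psi.
Proof. by rewrite /ell2_norm -rmorphD lecR ell2_rnormD. Qed.

Fact ell2_normZ (k : R[i]) phi : ell2_norm (k *: phi) = `|k| * ell2_norm phi.
Proof. by rewrite /ell2_norm ell2_rnormZ rmorphM. Qed.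

Fact ell2_norm_eq0 phi : ell2_norm phi = 0 -> phi = 0.
Proof. by move=> h; apply: ell2_rnorm_eq0; case: h. Qed.

HB.instance Definition _ := Lmodule_isNormed.Build R[i] ell2
  ell2_normD ell2_normZ ell2_norm_eq0.

End ell2_normed_module.

Section spectrum.
Context {K : numFieldType} {V : normedModType K}.

(* [z] is in the resolvent set iff [T - z] has a two-sided inverse among the
   bounded operators; for linear maps bounded and continuous are the same
   ([linear_bounded_continuous]). *)
Definition resolvent_set (T : {linear V -> V}) : set K^o :=
  [set z | exists S : {linear V -> V}, [/\ continuous S,
     cancel (fun x => T x - z *: x) S & cancel S (fun x => T x - z *: x)]].

Definition spectrum (T : {linear V -> V}) : set K^o := ~` resolvent_set T.

End spectrum.

Record sign_seq (R : realType) := SignSeq {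
  sign_seq_fun :> int -> R[i];
  sign_seqP : forall m, sign_seq_fun m = 1 \/ sign_seq_fun m = -1 }.

Definition periodic (T : Type) (c : int -> T) :=
  exists2 p : nat, (0 < p)%N & forall m : int, c (m + p%:Z) = c m.

Section hopping.
Variable R : realType.
Local Notation ell2 := (ell2 R).
Implicit Types (c : sign_seq R) (phi : ell2).

Definition hop_fun (c u : int -> R[i]) : int -> R[i] :=
  fun m => c m * u (m - 1) + u (m + 1).

Lemma sqr_sum_hop c phi : (sqr_sum (hop_fun c phi) <= 4%:E * sqr_sum phi)%E.
Proof.
have := sqr_sumD (fun m => c m * phi (m - 1)) (phi \o (+%R^~ 1)) ltr01.
rewrite sqr_sum_bij; last by exists (+%R^~ (-1)) => m; rewrite ?addrK ?subrK.
have -> : sqr_sum (fun m => c m * phi (m - 1)) = sqr_sum phi.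
  rewrite -[RHS](@sqr_sum_bij _ (+%R^~ (-1))); last first.
    by exists (+%R^~ 1) => m; rewrite ?addrK ?subrK.
  apply: eq_esum => m _ /=; rewrite Normc.normcM.
  by case: (sign_seqP c m) => ->; rewrite ?normcN Normc.normc1 mul1r.
by rewrite sqr_ell2_rnorm invr1 -!EFinM -!EFinD -mulrDl -natr1 => h;
  apply: le_trans h _; rewrite lee_fin ler_wpM2r ?sqr_ge0//; lra.
Qed.

Fact hop_square_summable c phi : hop_fun c phi \in square_summable.
Proof.
rewrite square_summableE; apply: le_lt_trans (sqr_sum_hop c phi) _.
by rewrite sqr_ell2_rnorm -EFinM ltry.
Qed.

Definition hop c : ell2 -> ell2 := fun phi => Ell2 (hop_square_summable c phi).

Fact hop_linear c : linear (hop c).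
Proof.
have hopE (a k x y x' y' : R[i]) : a * (k * x + y) + (k * x' + y') =
  k * (a * x + x') + (a * y + y') by ring.
by move=> k phi psi; apply: val_inj; apply/funext => m; exact: hopE.
Qed.

HB.instance Definition _ c :=
  GRing.isLinear.Build R[i] ell2 ell2 *:%R (hop c) (hop_linear c).

Lemma hop_continuous c : continuous (hop c).
Proof.
apply/linear_bounded_continuous/linear_boundedP.
near=> r => phi.
have h2 : ell2_rnorm (hop c phi) <= 2 * ell2_rnorm phi.
  rewrite -ler_sqr ?nnegrE ?mulr_ge0 ?ell2_rnorm_ge0//.
  rewrite -lee_fin exprMn [leRHS]EFinM -!sqr_ell2_rnorm.
  by apply: le_trans (sqr_sum_hop c phi) _; rewrite -natrX.
apply: (@le_trans _ _ (2 * `|phi|)).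
  rewrite -[`|hop c phi|]/(_%:C) -[`|phi|]/(_%:C).
  by rewrite -(rmorph_nat (real_complex R)) -rmorphM lecR.
by rewrite ler_wpM2r//; near: r; apply: nbhs_pinfty_ge; rewrite realn.
Unshelve. all: by end_near. Qed.

End hopping.

(* [R[i]^o] is [R[i]] seen as a normed module over itself; it is this copy that
   carries the usual topology of the complex plane. *)
Definition pi_infty (R : realType) : set R[i]^o :=
  \bigcup_(c in [set c : sign_seq R | periodic c]) spectrum (hop c).

Arguments pi_infty : clear implicits.

Definition Sigma_pi (R : realType) : set R[i]^o := closure (pi_infty R).
Arguments Sigma_pi : clear implicits.

(* Main.v *)
Require Import Defs.
From HB Require Import structures.
From mathcomp Require Import all_boot all_order all_algebra.
From mathcomp Require Import complex.
From mathcomp Require Import all_classical all_reals all_analysis.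
From mathcomp Require Import ring lra zify.
Import Order.TTheory GRing.Theory Num.Theory.
Import numFieldNormedType.Exports.
Local Open Scope classical_set_scope.
Local Open Scope ring_scope.

Set Implicit Arguments.
Unset Strict Implicit.
Unset Printing Implicit Defensive.

(* If the signs [c_(nj+1), ..., c_(nj+n-1)] are [- s_j, k_2, ..., k_(n-1)],
   with [k] a palindrome and [c_(nj) = s_j], eliminating the sites between the
   multiples of [n] turns [A_c u = z u] into [A_c' v = q(z) v] with
   [q(z) = z K(z)], [K] the Dirichlet determinant of the block, and [c'] an
   arbitrary sign sequence.  Hence preimages under [q] of the spectra of
   periodic operators are again in such spectra.  With [q(z) = z^2] and the
   spectrum [[-2, 2]] of [c = 1] this puts the unit disk in [Sigma_pi], and then
   [{z | |q(z)| < 1}] is an open subset of [Sigma_pi] around every root of [K].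
   Reflecting a word into a palindrome keeps the roots of its Dirichlet
   determinant.  If [t(z) = mu + mu^-1] is the discriminant of a word of period
   [n] repeated [N] times, this determinant is
   [(mu^N - mu^-N) / (mu - mu^-1)] times that of the word, so its roots
   accumulate at every [z] with [|mu| = 1], that is, at the whole spectrum. *)

Lemma shift_invariant_cst (T : Type) (f : int -> T) :
  (forall m, f (m + 1) = f m) -> forall m, f m = f 0.
Proof.
move=> fS; elim/int_rect => // k IH.
  by rewrite -IH -(fS k); congr f; lia.
by rewrite -IH -(fS (- k.+1%:Z)); congr f; lia.
Qed.

(** * Continuants and discriminants *)

Section continuant.
Variables (A : comNzRingType) (x : A) (c : int -> A).
Implicit Types (m : int) (u f : int -> A).

(* For [k > 0], the determinant of [x - A_c] restricted to the [k - 1] sites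
   [m, ..., m + k - 2]; as a function of [k] it is the solution of the eigenvalue
   equation vanishing at site [m - 1], shifted so that [k = 0] is that site. *)
Fixpoint continuant m k : A :=
  if k is k1.+1 then
    if k1 is k2.+1 then x * continuant m k1 - c (m + k2%:Z) * continuant m k2
    else 1
  else 0.

Lemma continuant0 m : continuant m 0 = 0. Proof. by []. Qed.

Lemma continuant1 m : continuant m 1 = 1. Proof. by []. Qed.

Lemma continuantSS m k :
  continuant m k.+2 = x * continuant m k.+1 - c (m + k%:Z) * continuant m k.
Proof. by []. Qed.

Arguments continuant : simpl never.

Lemma continuant_left m k :
  continuant m k.+2 =
  x * continuant (m + 1) k.+1 - c (m + 1) * continuant (m + 2) k.
Proof.
elim/ltn_ind: k m => -[|[|k]] IH m.
- by rewrite /continuant; ring.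
- by rewrite /continuant !mulr0 !subr0 !mulr1.
rewrite continuantSS (IH k.+1)// (IH k _ m)// !continuantSS.
have -> : m + k.+2%:Z = m + 1 + k.+1%:Z by lia.
have -> : m + 2 + k%:Z = m + 1 + k.+1%:Z by lia.
ring.
Qed.

(** The Wronskian of the Dirichlet solutions started at two consecutive sites; each step of the
    recurrence multiplies it by one value of [c]. *)
Lemma continuant_det m k :
  continuant m k.+1 * continuant (m + 1) k.+1
    - continuant m k.+2 * continuant (m + 1) k =
  \prod_(i < k) c (m + 1 + i%:Z).
Proof.
elim: k => [|k IH]; first by rewrite big_ord0 /continuant; ring.
rewrite big_ord_recr /= -IH (continuantSS m k.+1) (continuantSS (m + 1) k).
have -> : m + k.+1%:Z = m + 1 + k%:Z by lia.
ring.
Qed.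

(** Response at site [m + k] to the source [f], from zero data at [m - 1] and [m]. Unlike in
    [continuant], [k = 0] is the site [m]. *)
Fixpoint forcing f m k : A :=
  if k is k1.+1 then
    if k1 is k2.+1 then
      f (m + k1%:Z) + x * forcing f m k1 - c (m + k1%:Z) * forcing f m k2
    else f m
  else 0.

Lemma forcingSS f m k : forcing f m k.+2 =
  f (m + k.+1%:Z) + x * forcing f m k.+1 - c (m + k.+1%:Z) * forcing f m k.
Proof. by []. Qed.

Arguments forcing : simpl never.

Lemma forcingE f u : (forall m, u (m + 1) = f m + x * u m - c m * u (m - 1)) ->
  forall m k, u (m + k%:Z) =
    continuant m k.+1 * u m - c m * continuant (m + 1) k * u (m - 1) +
    forcing f m k.
Proof.
move=> hu m; elim/ltn_ind => -[|[|k]] IH.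
- by rewrite /continuant /forcing addr0; ring.
- by rewrite hu /continuant /forcing; ring.
have -> : m + k.+2%:Z = m + k.+1%:Z + 1 by lia.
rewrite hu (IH k.+1)//.
have -> : m + k.+1%:Z - 1 = m + k%:Z by lia.
rewrite (IH k)//.
rewrite forcingSS [continuant m k.+3]continuantSS.
rewrite [continuant (m + 1) k.+2]continuantSS.
have -> : m + 1 + k%:Z = m + k.+1%:Z by lia.
ring.
Qed.

(* The trace of the transfer matrix over the period [m, ..., m + n - 1]. *)
Definition discriminant n m : A :=
  continuant m n.+1 - c m * continuant (m + 1) n.-1.

(** What the source contributes to the Cayley-Hamilton identity over one period. Only finitely many
    values of [f] around [m] enter, which later makes it a bounded operator. *)
Definition period_rem f n m : A :=
  forcing f m n + c m * (continuant (m + 1) n.-1 * forcing f (m - n%:Z) n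
    - continuant (m + 1) n * forcing f (m - n%:Z) n.-1).

Section period.
Variable n : nat.
Hypotheses (n0 : (0 < n)%N) (pc : forall m, c (m + n%:Z) = c m).

Lemma continuant_period m k : continuant (m - n%:Z) k = continuant m k.
Proof.
elim/ltn_ind: k => -[|[|k]] IH //.
by rewrite !continuantSS !IH// -(pc (m - n%:Z + k%:Z)); congr (_ - c _ * _); lia.
Qed.

(** Moving the base point conjugates the transfer matrix, so the trace is unchanged: one continuant
    is expanded at its left end, the other at its right end, and periodicity identifies the border
    coefficients. *)
Lemma discriminantD1 m : discriminant n (m + 1) = discriminant n m.
Proof.
rewrite /discriminant; case: n n0 pc => // k _ pc'.
rewrite (continuant_left m k) (continuantSS (m + 1) k).
have -> : m + 1 + k%:Z = m + k.+1%:Z by lia.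
rewrite pc' /=.
have -> : m + 1 + 1 = m + 2 by lia.
ring.
Qed.

(* The Cayley-Hamilton identity for the transfer matrix over one period, of
   determinant 1, with an inhomogeneous term. *)
Lemma period_remE f u : (forall m, u (m + 1) = f m + x * u m - c m * u (m - 1)) ->
  (forall m, \prod_(i < n) c (m + i%:Z) = 1) ->
  forall m, u (m + n%:Z) + u (m - n%:Z) - discriminant n 0 * u m =
    period_rem f n m.
Proof.
move=> hu hd m; rewrite -(shift_invariant_cst discriminantD1 m).
rewrite /discriminant /period_rem.
have := hd m; have hp := pc (m - n%:Z).
have h1 := forcingE hu (m - n%:Z) n.
have h2 := forcingE hu (m - n%:Z) n.-1.
rewrite (forcingE hu m n).
move: h1 h2.
have -> : m - n%:Z + n%:Z = m by lia.
have -> : m - n%:Z + n.-1%:Z = m - 1 by lia.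
have -> : m - n%:Z + 1 = m + 1 - n%:Z by lia.
rewrite !continuant_period.
have -> : c (m - n%:Z) = c m by rewrite -hp; congr c; lia.
have : forall k, n = k.+1 ->
  c m * (continuant m k.+1 * continuant (m + 1) k.+1
    - continuant m k.+2 * continuant (m + 1) k) =
  \prod_(i < k.+1) c (m + i%:Z).
  move=> k _; rewrite continuant_det big_ord_recl addr0; congr (_ * _).
  by apply: eq_bigr => i _; congr c; rewrite /= /bump/=; lia.
case: n n0 => // k _ /(_ k erefl) hk.
rewrite -[k.+1.-1]/k => h1 h2 hd1; rewrite hd1 in hk.
move: (u (m - k.+1%:Z)) (u (m - k.+1%:Z - 1)) h1 h2 => a b h1 h2.
move: (continuant m k.+2) (continuant m k.+1) (continuant (m + 1) k.+1)
  (continuant (m + 1) k) (forcing _ _ _) (forcing _ _ _) (forcing _ _ _) (u m)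
  (u (m - 1)) (c m) hk h1 h2 => K2 K1 L1 L0 r r1 r2 um um' cm hk h1 h2.
(* Writing [a] as the determinant 1 times [a] amounts to inverting the transfer matrix; [h1] and
   [h2] eliminate the values one period back. *)
rewrite -{1}[a]mul1r -hk h2 {2}h1; ring: h1.
Qed.
End period.
End continuant.

Lemma eq_continuant (A : comNzRingType) (x : A) (c c' : int -> A) m k :
  (forall j, (j.+1 < k)%N -> c (m + j%:Z) = c' (m + j%:Z)) ->
  continuant x c m k = continuant x c' m k.
Proof.
elim/ltn_ind: k => -[|[|k]] IH h //.
rewrite !continuantSS h// !IH// => j hj; apply: h; lia.
Qed.

Section continuant_poly.
Variables (A : comNzRingType) (c : int -> A).
Implicit Types (m : int).
Let cX := continuant 'X (polyC \o c).

Lemma horner_continuant x m k : (cX m k).[x] = continuant x c m k.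
Proof.
elim/ltn_ind: k => -[|[|k]] IH; rewrite /cX.
- by rewrite !continuant0 horner0.
- by rewrite !continuant1 hornerE.
- by rewrite !continuantSS -/cX !hornerE !IH.
Qed.

(** Degree and monicity are what [root_continuity] asks for. *)
Lemma size_continuant m k : (size (cX m k.+1) = k.+1) * (cX m k.+1 \is monic).
Proof.
elim/ltn_ind: k => -[|k] IH; first by rewrite /cX continuant1 size_poly1 monic1.
have [s1 m1] := IH k (ltnSn k).
have sX : size ('X * cX m k.+1) = k.+2.
  by rewrite mulrC size_mulX ?monic_neq0// s1.
have sl : (size (- (polyC \o c) (m + k%:Z) * cX m k)%R < size ('X * cX m k.+1)%R)%N.
  rewrite sX mulNr size_polyN mul_polyC.
  apply: leq_ltn_trans (size_scale_leq _ _) _.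
  case: k IH {s1 m1 sX} => [|k] IH; first by rewrite /cX continuant0 size_poly0.
  by rewrite IH.
rewrite /cX continuantSS -mulNr -/cX size_polyDl// sX; split => //.
by rewrite monicE lead_coefDl// -monicE monicMl ?monicX.
Qed.

Lemma horner_discriminant x n m :
  (discriminant 'X (polyC \o c) n m).[x] = discriminant x c n m.
Proof.
by rewrite /discriminant !hornerE -/cX -/(cX _ _) !horner_continuant.
Qed.

Lemma size_discriminant n m : (0 < n)%N ->
  (size (discriminant 'X (polyC \o c) n m) = n.+1) *
  (discriminant 'X (polyC \o c) n m \is monic).
Proof.
case: n => // n _; rewrite /discriminant -mulNr -/cX -[n.+1.-1]/n.
have [s1 m1] := size_continuant m n.+1.
have sl : (size (- (polyC \o c) m * cX (m + 1) n)%R < size (cX m n.+2))%N.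
  rewrite s1 mulNr size_polyN mul_polyC.
  apply: leq_ltn_trans (size_scale_leq _ _) _.
  case: n {s1 m1} => [|n]; first by rewrite /cX continuant0 size_poly0.
  by rewrite size_continuant ltnS leqnSn.
rewrite size_polyDl// s1; split => //.
by rewrite monicE lead_coefDl// -monicE.
Qed.

End continuant_poly.

(** * Palindromic words *)

Section palindrome.
Variables (A : comNzRingType) (x : A) (k : int -> A) (n : nat).
Hypothesis kpal : forall i : nat, (1 < i < n)%N -> k (n.+1 - i)%N = k i.
Let X := continuant x k 1.
Implicit Types i : nat.

(* When [X M = 0] the solution [X] is odd, up to signs, under the reflection
   about site [M], so it vanishes at site [2 M] as it does at site [0]. *)
Lemma palindrome_root M : n = M.*2 -> X M = 0 -> X n = 0.
Proof.
move=> nM XM; case: M => [|M] in nM XM *; first by rewrite nM.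
have key i : (i <= M)%N -> exists e,
    X (M.+1 + i)%N = e * X (M.+1 - i)%N /\
    X (M.+1 + i).+1%N = e * k (M.+1 - i)%N * X (M - i)%N.
  elim: i => [|i IH] iM.
    exists (-1); rewrite addn0 !subn0 XM mulr0; split=> //.
    rewrite /X continuantSS -/X XM [1 + M%:Z]addrC.
    by rewrite (_ : M%:Z + 1 = M.+1%:Z); [ring|lia].
  have [e [e1 e2]] := IH (ltnW iM).
  exists (e * k (M.+1 - i)%N); rewrite addnS e2; split=> //.
  have [E1 E2] : (M - i = (M - i.+1).+1 /\ M.+1 - i = (M - i.+1).+2)%N by lia.
  have E3 : 1 + (M.+1 + i)%:Z = (n.+1 - (M - i.+1).+2)%N%:Z by lia.
  rewrite /X continuantSS -/X e2 e1 E3 kpal ?subSS ?E1 ?E2; last by lia.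
  rewrite [X (M - i.+1).+2]continuantSS -/X.
  have -> : 1 + (M - i.+1)%:Z = (M - i.+1).+1%:Z by lia.
  ring.
have [e [_ e2]] := key _ (leqnn M).
rewrite nM (_ : M.+1.*2 = (M.+1 + M).+1); last by lia.
by rewrite e2 subnn /X continuant0 mulr0.
Qed.

Variables (s v : int -> A).
Hypothesis n1 : (1 < n)%N.
Let g i := \prod_(2 <= l < i.+1) k l%:Z.

Definition interleave (m : int) : A :=
  let j := (m %/ n)%Z in let i := `|(m %% n)%Z|%N in
  if i is i'.+1 then if i' is _.+1 then k i%:Z else - s j else s j.

(** The solution on block [j] with end values [X n * v j] and [X n * v (j + 1)], scaled by [X n] to
    avoid division. [X i] vanishes at the left end and [X (n - i)] at the right end; the palindrome
    makes the latter a solution up to the signs [g i]. *)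
Let cell j i := if i == 0%N then X n * v j
  else v (j + 1) * X i - s j * g i * v j * X (n - i).

Let lift_sol (m : int) : A := cell (m %/ n)%Z `|(m %% n)%Z|%N.

(** At a site [j n] the two terms in [X (n - 1) * v j] cancel, because the signs at [j n] and
    [j n + 1] are opposite; the hypothesis on [v] is what remains. Inside a block the equation is
    the recurrence of [X] read from both ends. As [a], [b], [d] do not depend on [j], bounds pass
    from [v] to [u]. *)
Lemma palindrome_lift :
  (forall j, v (j + 1) - s j * s (j - 1) * g n.-1 * v (j - 1) = x * X n * v j) ->
  exists u, [/\ forall j, u (j * n%:Z) = X n * v j,
    forall m, interleave m * u (m - 1) + u (m + 1) = x * u m &
    exists a b d : nat -> A, forall j i, (i < n)%N ->
      u (j * n%:Z + i%:Z) = a i * v (j + 1) + (b i + d i * s j) * v j].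
Proof.
move=> hv.
have dm j i : (i < n)%N -> ((j * n%:Z + i%:Z) %/ n)%Z = j /\
    `|((j * n%:Z + i%:Z) %% n)%Z|%N = i.
  move=> ilt; split; first by rewrite divzMDl ?divz_small; lia.
  by rewrite modzMDl modz_small; lia.
have ljn j : lift_sol (j * n%:Z) = X n * v j.
  by rewrite /lift_sol -[j * n%:Z]addr0; have [-> ->] := dm j 0%N ltac:(lia).
have liE j i : (i <= n)%N -> lift_sol (j * n%:Z + i%:Z) = cell j i.
  rewrite leq_eqVlt => /orP[/eqP ->|ilt]; last first.
    by rewrite /lift_sol; have [-> ->] := dm j i ilt.
  have -> : j * n%:Z + n%:Z = (j + 1) * n%:Z by ring.
  rewrite ljn /cell ifF; last by lia.
  by rewrite subnn [X 0]continuant0 mulr0 subr0 mulrC.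
exists lift_sol; split=> // [m|]; last first.
  exists (fun i => if i == 0%N then 0 else X i).
  exists (fun i => if i == 0%N then X n else 0).
  exists (fun i => if i == 0%N then 0 else - (g i * X (n - i))) => j i /ltnW iln.
  by rewrite liE// /cell; case: ifP => _; ring.
set j := (m %/ n)%Z; set i := `|(m %% n)%Z|%N.
have iln : (i < n)%N.
  by rewrite /i; have := @ltz_pmod m n%:Z; have := @modz_ge0 m n%:Z; lia.
have mE : m = j * n%:Z + i%:Z.
  by rewrite {1}(divz_eq m n) /i; have := @modz_ge0 m n%:Z; lia.
have -> : interleave m =
  if i is i'.+1 then if i' is _.+1 then k i%:Z else - s j else s j by [].
rewrite mE.
have -> : j * n%:Z + i%:Z + 1 = j * n%:Z + i.+1%:Z by lia.
rewrite !liE; try lia.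
have gS l : (0 < l)%N -> g l.+1 = g l * k l.+1%:Z.
  by move=> l0; rewrite /g big_nat_recr//=; lia.
have g1 : g 1 = 1 by rewrite /g big_geq.
have X1 : X 1 = 1 by [].
have X0 : X 0 = 0 by [].
have XSS l : X l.+2 = x * X l.+1 - k l.+1%:Z * X l.
  by rewrite /X continuantSS; congr (_ - k _ * _); lia.
case: i iln {mE} => [_|i iln].
  have -> : j * n%:Z + 0%:Z - 1 = (j - 1) * n%:Z + n.-1%:Z by lia.
  rewrite liE; last by lia.
  rewrite /cell /= ifF; last by lia.
  have -> : (n - n.-1 = 1)%N by lia.
  rewrite X1 g1 subrK mulrA -hv subn1; ring.
have -> : j * n%:Z + i.+1%:Z - 1 = j * n%:Z + i%:Z by lia.
rewrite liE; last by lia.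
case: i iln => [|i] iln.
  rewrite /cell /= X1 g1 XSS X1 X0.
  (* For [n = 2] the palindrome condition is empty, but [X (n - 2) = X 0 = 0] removes the term in
     [k 2]. *)
  have [n2|n2] : n = 2 \/ (2 < n)%N by lia.
    by rewrite n2 /= XSS X1 X0; ring.
  have kE : k 2%N = k n.-1.
    have <- : (n.+1 - n.-1 = 2)%N by lia.
    by rewrite kpal//; lia.
  have -> : X n = x * X (n - 1) - k n.-1 * X (n - 2).
    case: n n1 n2 => [|[|l]]// _ _; rewrite XSS; congr (_ * X _ - _ * X _); lia.
  rewrite (gS 1%N)// g1 kE; ring.
rewrite /cell /= XSS (gS i.+2)// (gS i.+1)//.
have [ni|ni] : n = i.+3 \/ (i.+3 < n)%N by lia.
  have -> : (n - i.+3 = 0)%N by lia.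
  have -> : (n - i.+2 = 1)%N by lia.
  have -> : (n - i.+1 = 2)%N by lia.
  rewrite (XSS 0%N) X1 X0; ring.
have -> : X (n - i.+1) = x * X (n - i.+2) - k i.+3 * X (n - i.+3).
  rewrite -(kpal (i := i.+3)); last by lia.
  have -> : (n - i.+1 = (n - i.+3).+2)%N by lia.
  have -> : (n - i.+2 = (n - i.+3).+1)%N by lia.
  by rewrite XSS; congr (_ - k _ * _); lia.
ring.
Qed.

End palindrome.

(** * Two-sided recurrences and Floquet multipliers *)

Lemma int_recursion (T : Type) (fwd bwd : int -> T -> T) (p0 : T) :
  (forall m, cancel (bwd m) (fwd m)) ->
  exists2 p : int -> T, p 0 = p0 & forall m, p (m + 1) = fwd m (p m).
Proof.
move=> hK.
pose pos := fix pos n := if n is n'.+1 then fwd n'%:Z (pos n') else p0.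
pose neg := fix neg n :=
  bwd (Negz n) (if n is n'.+1 then neg n' else p0).
exists (fun m => match m with Posz n => pos n | Negz n => neg n end) => // -[n|n].
  by rewrite -PoszD addn1.
case: n => [|n]; first by rewrite /= hK.
have -> : Negz n.+1 + 1 = Negz n by lia.
by rewrite [neg n.+1]/= hK.
Qed.

Section recurrence.
Variables (A : comNzRingType) (x : A) (c : int -> A).
Implicit Types (m : int) (u f : int -> A).

(** Since [c m] is its own inverse, pairs of consecutive values can be propagated in both
    directions. *)
Lemma recurrence_solution f a b : (forall m, c m * c m = 1) ->
  exists u, [/\ u 0 = a, u 1 = b &
    forall m, u (m + 1) = f m + x * u m - c m * u (m - 1)].
Proof.
move=> c1.
pose fwd m (p : A * A) := (p.2, f (m + 1) + x * p.2 - c (m + 1) * p.1).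
pose bwd m (p : A * A) := (c (m + 1) * (f (m + 1) + x * p.1 - p.2), p.1).
have bfK m : cancel (bwd m) (fwd m).
  by case=> y z; rewrite /fwd /bwd /= mulrA c1; congr pair; ring.
have [p p0 pS] := int_recursion (a, b) bfK.
have p2 m : (p m).2 = (p (m + 1)).1 by rewrite pS.
exists (fun m => (p m).1); split=> [||m]; first by rewrite p0.
  by rewrite -[1]add0r -p2 p0.
have -> : m = m - 1 + 1 by ring.
by rewrite -p2 pS /= p2 addrK.
Qed.

Lemma forcing0 m k : forcing x c (fun=> 0) m k = 0.
Proof.
elim/ltn_ind: k => -[|[|k]] IH //.
by rewrite forcingSS !IH// !mulr0 subr0 addr0.
Qed.

Lemma period_rem0 n m : period_rem x c (fun=> 0) n m = 0.
Proof. by rewrite /period_rem !forcing0 !mulr0 subrr mulr0 addr0. Qed.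

End recurrence.

Section floquet.
Variables (F : fieldType) (x : F) (c : int -> F) (n : nat) (mu : F).
Hypotheses (n0 : (0 < n)%N) (c1 : forall m, c m * c m = 1).
Hypothesis pc : forall m, c (m + n%:Z) = c m.
Hypothesis dc : forall m, \prod_(i < n) c (m + i%:Z) = 1.

(** On the multiples of [n] the Dirichlet solution obeys a three-term recurrence with characteristic
    roots [mu] and [mu^-1], so [mu ^+ N = mu ^- N] makes it vanish at [N * n]. *)
Lemma continuant_multiple N : mu != 0 -> mu ^+ N = -1 -> mu ^+ 2 != 1 ->
  discriminant x c n 0 = mu + mu^-1 -> continuant x c 1 (N * n)%N = 0.
Proof.
move=> mu0 muN mu2 tmu.
have [u [u0 u1 hu]] := recurrence_solution x (fun=> 0) 0 1 c1.
have uE k : u k%:Z = continuant x c 1 k.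
  case: k => [|k]; first by rewrite u0.
  have := forcingE hu 1 k.
  rewrite subrr u0 u1 forcing0 mulr0 subr0 addr0 mulr1 => <-.
  by congr u; lia.
have step j : u (j.+2 * n)%N%:Z = (mu + mu^-1) * u (j.+1 * n)%N%:Z - u (j * n)%N%:Z.
  have := period_remE n0 pc hu dc (j.+1 * n)%N%:Z.
  rewrite period_rem0 tmu => /eqP; rewrite subr_eq0 => /eqP <-.
  rewrite (_ : _ - n%:Z = (j * n)%N%:Z) ?addrK; last by lia.
  by congr u; lia.
have key j : (mu - mu^-1) * u (j * n)%N%:Z = (mu ^+ j - mu ^- j) * u n%:Z.
  elim/ltn_ind: j => -[|[|j]] IH.
  - by rewrite mul0n u0 expr0 invr1 subrr mul0r mulr0.
  - by rewrite mul1n expr1.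
  rewrite step mulrBr mulrCA (IH j.+1)// (IH j)//.
  by rewrite -!exprVn !exprS; field.
have /eqP := key N; rewrite muN invrN1 subrr mul0r mulf_eq0 subr_eq0.
rewrite uE => /orP[/eqP E|/eqP//]; case/negP: mu2.
by rewrite expr2 {2}E mulfV.
Qed.
End floquet.

(** * Roots of complex polynomials *)

Section closed_num.
Variable C : numClosedFieldType.
Implicit Types (u z w : C).

(** If all [n] roots of [p - w] were at distance at least [e] from [z], the product of the
    distances, [|p(z) - w|], would be at least [e ^+ n]. *)
Lemma root_continuity (p : {poly C}) n z w (e : C) : p \is monic ->
  size p = n.+1 -> (0 < n)%N -> 0 < e -> `|p.[z] - w| < e ^+ n ->
  exists2 z', p.[z'] = w & `|z - z'| < e.
Proof.
move=> pm ps n0 e0 h.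
have szw : (size (- w%:P) < size p)%N.
  by rewrite size_polyN ps (leq_ltn_trans (size_polyC_leq1 _)).
have pwm : p - w%:P \is monic by rewrite monicE lead_coefDl// -monicE.
have pws : size (p - w%:P) = n.+1 by rewrite size_polyDl.
have [r rE] := closed_field_poly_normal (p - w%:P).
rewrite (monicP pwm) scale1r in rE.
have sr : size r = n by apply/eq_add_S; rewrite -pws rE size_prod_XsubC.
have [/hasP[z' z'r ltz]|/hasPn far] := boolP (has (fun z' => `|z - z'| < e) r).
  exists z' => //; apply/eqP; rewrite -subr_eq0 -[X in _ - X](hornerC w z').
  by rewrite -hornerN -hornerD rE -rootE root_prod_XsubC.
suff : e ^+ n <= `|p.[z] - w| by move=> /(lt_le_trans h); rewrite ltxx.
rewrite -[X in _ - X](hornerC w z) -hornerN -hornerD rE horner_prod normr_prod.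
rewrite -sr; elim: r far {rE sr} => [|y r IH] far; first by rewrite big_nil.
rewrite big_cons hornerXsubC /= exprS ler_pM ?exprn_ge0 ?(ltW e0)//.
  by rewrite real_leNgt ?normr_real ?gtr0_real//; apply: far; exact: mem_head.
by apply: IH => y' hy'; apply: far; rewrite inE hy' orbT.
Qed.

(* A square root of an approximation of [u ^+ 2] on the unit circle, with the
   right choice of sign, is closer to [u] by a factor [sqrt 2]. *)
Lemma roots_of_minus_one_dense u k : `|u| = 1 -> exists2 w,
  w ^+ (2 ^ k) = -1 & `|u - w| ^+ 2 * 2 ^+ k <= 4.
Proof.
elim: k u => [|k IH] u u1.
  exists (-1); rewrite ?expr1// mulr1 opprK.
  rewrite -[4]/(2 * 2)%:R natrM -expr2 lerXn2r ?nnegrE//.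
  by rewrite (le_trans (ler_normD _ _))// u1 normr1.
have [|w1 w1k w1u] := IH (u ^+ 2); first by rewrite normrX u1 expr1n.
have [w w2] : exists w, w ^+ 2 = w1 by exists (sqrtC w1); rewrite sqrtCK.
have nw1 : `|w| = 1.
  apply/eqP; rewrite -(@pexpr_eq1 _ _ (2 ^ k.+1))// ?expn_gt0//.
  by rewrite -normrX expnS exprM w2 w1k normrN1.
have par : `|u + w| ^+ 2 + `|u - w| ^+ 2 = 4.
  have : `|u| ^+ 2 = 1 by rewrite u1 expr1n.
  have : `|w| ^+ 2 = 1 by rewrite nw1 expr1n.
  rewrite !normCK !rmorphD !rmorphN /= => hw hu.
  have -> : 4 = 2 * (u * u^* + w * w^*) by rewrite hu hw; ring.
  ring.
wlog le : w w2 nw1 par / `|u - w| <= `|u + w|.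
  move=> H; have [/H|/ltW le] := real_leP (normr_real (u - w)) (normr_real (u + w)).
    exact.
  by apply: (H (- w)); rewrite ?sqrrN ?normrN ?opprK// addrC.
exists w; first by rewrite expnS exprM w2.
apply: le_trans w1u; rewrite -w2 subr_sqr normrM exprMn [2 ^+ k.+1]exprS.
rewrite mulrA ler_wpM2r ?exprn_ge0// ler_wpM2l ?exprn_ge0//.
have : `|u - w| ^+ 2 <= `|u + w| ^+ 2 by rewrite lerXn2r ?nnegrE.
move: par; set a := _ ^+ 2; set b := _ ^+ 2 => par ba.
have -> : 2 = (a + b) / 2 by rewrite par; field.
by rewrite ler_pdivrMr// mulr_natr mulr2n lerD2l.
Qed.

Lemma horner_small (q : {poly C}) z0 : q.[z0] = 0 ->
  exists2 e : C, 0 < e & forall z, `|z - z0| < e -> `|q.[z]| < 1.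
Proof.
move=> /eqP/factor_theorem [p ->].
have [b hb] := poly_disk_bound p (`|z0| + 1).
have b0 : 0 <= b.
  by apply: le_trans (hb z0 _); rewrite // lerDl.
(* This radius is at most 1, so [z] stays in the disk where [b] bounds the cofactor, and the value
   is at most [b / (b + 1)]. *)
exists (b + 1)^-1; first by rewrite invr_gt0 ltr_wpDl.
move=> z hz; rewrite hornerM hornerXsubC normrM.
have b1 : 0 < b + 1 by rewrite ltr_wpDl.
have z1 : `|z| <= `|z0| + 1.
  rewrite -[z](subrK z0) addrC (le_trans (ler_normD _ _))// lerD2l.
  by rewrite (le_trans (ltW hz))// invf_le1// lerDr.
apply: le_lt_trans (_ : b / (b + 1) < 1).
  by rewrite ler_pM// ?hb// ltW.
by rewrite ltr_pdivrMr// mul1r ltrDl.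
Qed.
End closed_num.

(** * Upper bound on the spectrum *)

(** The lower bound gives injectivity, so a choice of preimages is automatically linear, and it
    bounds this inverse by [M]. *)
Lemma resolvent_setI (K : numFieldType) (V : normedModType K)
    (T : {linear V -> V}) (z M : K) :
  0 <= M -> (forall x, `|x| <= M * `|T x - z *: x|) ->
  (forall y, exists x, T x - z *: x = y) -> resolvent_set T z.
Proof.
move=> M0 hM /choice[g gD]; pose D x := T x - z *: x.
have Dlin a x y : D (a *: x + y) = a *: D x + D y.
  rewrite /D linearP !scalerDr !scalerN !scalerA mulrC addrACA opprD.
  by rewrite -!scalerA.
have Dinj : injective D.
  move=> x y Dxy; apply/eqP; rewrite -subr_eq0 -normr_le0.
  apply: le_trans (hM _) _; rewrite -[X in `|X|]/(D (x - y)).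
  by rewrite -scaleN1r addrC Dlin Dxy scaleN1r addNr normr0 mulr0.
have Dg : cancel D g by move=> x; apply: Dinj; exact: gD.
have glin : linear g.
  by move=> a x y; apply: Dinj; rewrite Dlin /D !gD.
pose L := GRing.isLinear.Build _ _ _ _ g glin.
pose S : {linear V -> V} := HB.pack g L.
have SM x : `|S x| <= M * `|x| by apply: le_trans (hM _) _; rewrite gD.
exists S; split => //.
apply/linear_bounded_continuous/linear_boundedP.
near=> r => x; apply: le_trans (SM x) _; rewrite ler_wpM2r//.
by near: r; apply: nbhs_pinfty_ge; exact: ger0_real.
Unshelve. all: by end_near. Qed.

Section modulus.
Variable R : realType.
Local Notation Re := (@complex.Re R).
Local Notation Im := (@complex.Im R).
Implicit Types (z w : R[i]).

Lemma normr_normc z : `|z| = (Normc.normc z)%:C%C. Proof. by []. Qed.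

Lemma normc_ge0 z : 0 <= Normc.normc z.
Proof. by case: z => ? ?; exact: sqrtr_ge0. Qed.

Lemma Re_le_normc z : `|Re z| <= Normc.normc z.
Proof.
case: z => a b /=; rewrite -sqrtr_sqr ler_wsqrtr// lerDl; exact: sqr_ge0.
Qed.

Lemma Im_le_normc z : `|Im z| <= Normc.normc z.
Proof.
case: z => a b /=; rewrite -sqrtr_sqr ler_wsqrtr// lerDr; exact: sqr_ge0.
Qed.

Lemma sqr_normc z : Normc.normc z ^+ 2 = Re z ^+ 2 + Im z ^+ 2.
Proof. by case: z => a b; rewrite sqr_sqrtr// addr_ge0 ?sqr_ge0. Qed.

Lemma geometric_increments_cvg (a : nat -> R) M r : 0 <= r -> r < 1 -> 0 <= M ->
  (forall N, `|a N.+1 - a N| <= M * r ^+ N) -> cvgn a.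
Proof.
move=> r0 r1 M0 ha.
have : cvgn (series (telescope a)).
  apply: normed_cvg; apply: (@series_le_cvg _ _ (geometric M r)) => [n|n|n|] //=.
  - by rewrite mulr_ge0// exprn_ge0.
  - exact: ha.
  - by apply: is_cvg_geometric_series; rewrite ger0_norm.
rewrite telescopeK => cva.
have -> : a = (fun n => a n - a 0%N) + cst (a 0%N).
  by apply/funext => n; rewrite /= fctE /= subrK.
by apply: is_cvgD => //; exact: is_cvg_cst.
Qed.

Lemma complex_increments_cvg (a : nat -> R[i]) M r : 0 <= r -> r < 1 -> 0 <= M ->
  (forall N, Normc.normc (a N.+1 - a N) <= M * r ^+ N) ->
  exists l : R[i], (Re \o a @ \oo --> Re l) /\
                   (Im \o a @ \oo --> Im l).
Proof.
move=> r0 r1 M0 ha.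
have cR : cvgn (Re \o a).
  apply: (geometric_increments_cvg r0 r1 M0) => N.
  by rewrite /= -raddfB; apply: le_trans (Re_le_normc _) (ha N).
have cI : cvgn (Im \o a).
  apply: (geometric_increments_cvg r0 r1 M0) => N.
  by rewrite /= -raddfB; apply: le_trans (Im_le_normc _) (ha N).
by exists (Complex (limn (Re \o a)) (limn (Im \o a))); split;
  [exact: cR|exact: cI].
Qed.

End modulus.

Section ell2_limits.
Variable R : realType.
Local Notation Re := (@complex.Re R).
Local Notation Im := (@complex.Im R).
Local Notation ell2 := (ell2 R).
Implicit Types (phi psi : ell2).

Lemma ell2_normE phi : `|phi| = (ell2_rnorm phi)%:C%C. Proof. by []. Qed.

Lemma ell2_coord phi m : Normc.normc (phi m) <= ell2_rnorm phi.
Proof.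
rewrite -ler_sqr ?nnegrE ?normc_ge0 ?ell2_rnorm_ge0// -lee_fin -sqr_ell2_rnorm.
apply: esum_ge; exists [set m]; first by split.
by rewrite fsbig_set1.
Qed.

(** Fatou's argument: every finite sum of squares passes to the coordinatewise limit and keeps the
    bound [M ^+ 2]. *)
Lemma ell2_limit (a : nat -> ell2) (u : int -> R[i]) (M : R) :
  (forall N, ell2_rnorm (a N) <= M) ->
  (forall m, (fun N => Re (a N m)) @ \oo --> Re (u m)) ->
  (forall m, (fun N => Im (a N m)) @ \oo --> Im (u m)) ->
  u \in square_summable.
Proof.
move=> aM uR uI; rewrite square_summableE.
apply: (@le_lt_trans _ _ (M ^+ 2)%:E); last by rewrite ltry.
apply: ge_ereal_sup => _ [F [finF _] <-].
have M0 : 0 <= M by apply: le_trans (aM 0%N); exact: ell2_rnorm_ge0.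
rewrite fsbig_finite//= sumEFin lee_fin.
pose sF := finmap.enum_fset (fset_set F).
have cv : (\sum_(m <- sF) Normc.normc (a N m) ^+ 2) @[N --> \oo] -->
    \sum_(m <- sF) Normc.normc (u m) ^+ 2.
  apply: cvg_big => [|m _]; first exact: add_continuous.
  under eq_fun do rewrite sqr_normc; rewrite sqr_normc.
  by apply: cvgD; rewrite !expr2; apply: cvgM.
apply: (cvgr_to_le cv); apply: nearW => N.
rewrite -lee_fin -sumEFin -fsbig_finite//.
apply: (@le_trans _ _ (sqr_sum (a N))); first by apply: esum_ge; exists F.
by rewrite sqr_ell2_rnorm lee_fin ler_sqr ?nnegrE ?ell2_rnorm_ge0.
Qed.
End ell2_limits.

Section bounded_operators.
Variable R : realType.
Local Notation ell2 := (ell2 R).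
Local Notation Re := (@complex.Re R).
Local Notation Im := (@complex.Im R).
Implicit Types (phi psi : ell2) (u : int -> R[i]) (s : int).

Lemma sqr_sum_shift s u : sqr_sum (fun m => u (m + s)) = sqr_sum u.
Proof.
apply: (@sqr_sum_bij _ (+%R^~ s)); exists (+%R^~ (- s)) => m.
  by rewrite addrK.
by rewrite subrK.
Qed.

Fact shift_square_summable s phi : (fun m => phi (m + s)) \in square_summable.
Proof. by rewrite square_summableE sqr_sum_shift -square_summableE ell2_mem. Qed.

Definition ell2_shift s phi : ell2 := Ell2 (shift_square_summable s phi).

Lemma ell2_shiftB s phi psi :
  ell2_shift s (phi - psi) = ell2_shift s phi - ell2_shift s psi.
Proof. exact: val_inj. Qed.

Lemma ell2_rnorm_shift s phi : ell2_rnorm (ell2_shift s phi) = ell2_rnorm phi.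
Proof. by rewrite /ell2_rnorm sqr_sum_shift. Qed.

Lemma ell2_rnorm0 : ell2_rnorm (0 : ell2) = 0.
Proof. by rewrite /ell2_rnorm sqr_sum0 sqrtr0. Qed.

Lemma neumann_bounded_below s (mu : R[i]) phi :
  (1 - Normc.normc mu) * ell2_rnorm phi <= ell2_rnorm (phi - mu *: ell2_shift s phi).
Proof.
have := ell2_rnormD (phi - mu *: ell2_shift s phi) (mu *: ell2_shift s phi).
rewrite subrK ell2_rnormZ ell2_rnorm_shift mulrBl mul1r; lra.
Qed.

(** Neumann series: as the shift is isometric, the partial sums have geometric increments and
    converge at every site; [ell2_limit] puts the limit in [ell2]. *)
Lemma neumann_surjective s (mu : R[i]) psi : Normc.normc mu < 1 ->
  exists phi, phi - mu *: ell2_shift s phi = psi.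
Proof.
set r := Normc.normc mu => r1.
have r0 : 0 <= r by exact: normc_ge0.
pose step phi := psi + mu *: ell2_shift s phi.
pose a N := iter N step 0.
have aS N : a N.+1 = psi + mu *: ell2_shift s (a N) by [].
have aB N : ell2_rnorm (a N) <= ell2_rnorm psi / (1 - r).
  elim: N => [|N IH].
    by rewrite ell2_rnorm0 divr_ge0 ?ell2_rnorm_ge0// subr_ge0 ltW.
  rewrite aS (le_trans (ell2_rnormD _ _))// ell2_rnormZ ell2_rnorm_shift -/r.
  have -> : ell2_rnorm psi / (1 - r) =
      ell2_rnorm psi + r * (ell2_rnorm psi / (1 - r)).
    by field; rewrite subr_eq0 gt_eqF.
  by rewrite lerD2l ler_wpM2l.
have aD N : ell2_rnorm (a N.+1 - a N) <= ell2_rnorm psi * r ^+ N.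
  elim: N => [|N IH].
    have -> : a 1%N - a 0%N = psi + mu *: ell2_shift s 0 by rewrite aS subr0.
    have -> : ell2_shift s 0 = 0 by exact: val_inj.
    by rewrite scaler0 addr0 expr0 mulr1.
  rewrite aS [in X in _ - X]aS opprD addrACA subrr add0r -scalerBr -ell2_shiftB.
  by rewrite ell2_rnormZ ell2_rnorm_shift exprS mulrCA ler_wpM2l.
have /choice[u hu] m : exists l : R[i],
    (fun N => Re (a N m)) @ \oo --> Re l /\ (fun N => Im (a N m)) @ \oo --> Im l.
  apply: (complex_increments_cvg r0 r1 (ell2_rnorm_ge0 psi)) => N.
  exact: le_trans (ell2_coord (a N.+1 - a N) m) (aD N).
have uR m := (hu m).1; have uI m := (hu m).2.
have us := ell2_limit aB uR uI.
exists (Ell2 us); apply: val_inj; apply/funext => m.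
have ReM (x y : R[i]) : Re (x * y) = Re x * Re y - Im x * Im y.
  by case: x y => ? ? [].
have ImM (x y : R[i]) : Im (x * y) = Re x * Im y + Im x * Re y.
  by case: x y => ? ? [].
have aE N : a N.+1 m = psi m + mu * a N (m + s) by rewrite aS.
have e1 : Re (u m) = Re (psi m) + (Re mu * Re (u (m + s)) - Im mu * Im (u (m + s))).
  have c1 : (fun N => Re (a N.+1 m)) @ \oo --> Re (u m).
    by rewrite (cvg_shiftS (fun N => Re (a N m))).
  rewrite -(cvg_lim (@norm_hausdorff _ _) c1).
  apply: cvg_lim; first exact: norm_hausdorff.
  under eq_fun do rewrite aE raddfD /= ReM.
  by apply: cvgD; [exact: cvg_cst|apply: cvgB; apply: cvgMr].
have e2 : Im (u m) = Im (psi m) + (Re mu * Im (u (m + s)) + Im mu * Re (u (m + s))).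
  have c1 : (fun N => Im (a N.+1 m)) @ \oo --> Im (u m).
    by rewrite (cvg_shiftS (fun N => Im (a N m))).
  rewrite -(cvg_lim (@norm_hausdorff _ _) c1).
  apply: cvg_lim; first exact: norm_hausdorff.
  under eq_fun do rewrite aE raddfD /= ImM.
  by apply: cvgD; [exact: cvg_cst|apply: cvgD; apply: cvgMr].
rewrite -[LHS]/(u m - mu * u (m + s)).
have -> : u m = psi m + mu * u (m + s).
  apply/eqP; rewrite eq_complex; apply/andP; split; apply/eqP.
    by rewrite e1 raddfD /= ReM.
  by rewrite e2 raddfD /= ImM.
by rewrite addrK.
Qed.

(** The bound is on squared norms. [F] acts on all sequences and [sqr_sum] may be infinite, so the
    inequality also says that [F] preserves square summability. *)
Definition ell2_bounded (F : (int -> R[i]) -> int -> R[i]) :=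
  exists2 C : R, 0 <= C & forall u, (sqr_sum (F u) <= C%:E * sqr_sum u)%E.

Lemma ell2_boundedD F G : ell2_bounded F -> ell2_bounded G ->
  ell2_bounded (fun u m => F u m + G u m).
Proof.
move=> [C C0 hF] [D D0 hG]; exists (2 * C + 2 * D).
  by rewrite addr_ge0// mulr_ge0.
move=> u; apply: le_trans (sqr_sumD (F u) (G u) ltr01) _.
rewrite invr1 (_ : 1 + 1 = 2)//.
rewrite [(2 * C + 2 * D)%:E]EFinD ge0_muleDl ?lee_fin ?mulr_ge0// !EFinM -!muleA.
by rewrite leeD// lee_wpmul2l// lee_fin.
Qed.

Lemma ell2_boundedM (b : int -> R[i]) (B : R) F :
  (forall m, Normc.normc (b m) <= B) -> ell2_bounded F ->
  ell2_bounded (fun u m => b m * F u m).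
Proof.
move=> hb [C C0 hF]; have B0 : 0 <= B by apply: le_trans (hb 0); exact: normc_ge0.
exists (B ^+ 2 * C); first by rewrite mulr_ge0// exprn_ge0.
move=> u; apply: (@le_trans _ _ ((B ^+ 2)%:E * sqr_sum (F u))%E); last first.
  by rewrite [(_ * C)%:E]EFinM -muleA lee_wpmul2l// lee_fin exprn_ge0.
rewrite /sqr_sum -esum_scale ?exprn_ge0//; last by move=> m; rewrite lee_fin sqr_ge0.
apply: le_esum => m _; rewrite -EFinM lee_fin Normc.normcM exprMn.
by rewrite ler_wpM2r ?sqr_ge0// ler_sqr ?nnegrE ?normc_ge0.
Qed.

Lemma ell2_bounded_shift s F : ell2_bounded F ->
  ell2_bounded (fun u m => F u (m + s)).
Proof. by move=> [C C0 hF]; exists C => // u; rewrite sqr_sum_shift. Qed.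

Lemma ell2_bounded_id : ell2_bounded id.
Proof. by exists 1 => // u; rewrite mul1e. Qed.

Lemma ell2_bounded0 : ell2_bounded (fun=> 0).
Proof. by exists 0 => // u; rewrite sqr_sum0 mul0e. Qed.

Section sign.
Variables (c : int -> R[i]) (z : R[i]).
Hypothesis c1 : forall m, Normc.normc (c m) = 1.

Lemma normc_continuant_le m k :
  Normc.normc (continuant z c m k) <= (Normc.normc z + 1) ^+ k.
Proof.
have z0 := normc_ge0 z.
elim/ltn_ind: k m => -[|[|k]] IH m.
- by rewrite continuant0 Normc.normc0.
- by rewrite continuant1 Normc.normc1 expr1 lerDr.
rewrite continuantSS; apply: le_trans (le_normcD _ _) _.
rewrite normcN !Normc.normcM c1 mul1r.
apply: (@le_trans _ _ (Normc.normc z * (Normc.normc z + 1) ^+ k.+1 +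
    (Normc.normc z + 1) ^+ k)).
  by rewrite lerD ?ler_wpM2l ?IH.
rewrite [leRHS]exprS mulrDl mul1r lerD2l ler_weXn2l// lerDr//.
Qed.

Lemma ell2_bounded_forcing k : ell2_bounded (fun f m => forcing z c f m k).
Proof.
elim/ltn_ind: k => -[|[|k]] IH.
- exact: ell2_bounded0.
- exact: ell2_bounded_id.
have -> : (fun f m => forcing z c f m k.+2) = fun f m =>
   (f (m + k.+1%:Z) + z * forcing z c f m k.+1) +
   (- c (m + k.+1%:Z)) * forcing z c f m k.
  by apply/funext => f; apply/funext => m; rewrite forcingSS mulNr.
apply: ell2_boundedD.
  apply: ell2_boundedD; first exact: (ell2_bounded_shift _ ell2_bounded_id).
  exact: (@ell2_boundedM (fun=> z) (Normc.normc z) _ _ (IH _ _)).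
by apply: (@ell2_boundedM _ 1 _ _ (IH _ _)) => // m; rewrite normcN c1.
Qed.

Lemma ell2_bounded_period_rem n : ell2_bounded (fun f m => period_rem z c f n m).
Proof.
have -> : (fun f m => period_rem z c f n m) = fun f m => forcing z c f m n +
    (c m * continuant z c (m + 1) n.-1 * forcing z c f (m - n%:Z) n +
     - c m * continuant z c (m + 1) n * forcing z c f (m - n%:Z) n.-1).
  by apply/funext => f; apply/funext => m; rewrite /period_rem; ring.
apply: ell2_boundedD; first exact: ell2_bounded_forcing.
apply: ell2_boundedD.
  apply: (@ell2_boundedM _ ((Normc.normc z + 1) ^+ n.-1)) => [m|].
    by rewrite Normc.normcM c1 mul1r normc_continuant_le.
  exact: (ell2_bounded_shift _ (ell2_bounded_forcing _)).
apply: (@ell2_boundedM _ ((Normc.normc z + 1) ^+ n)) => [m|].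
  by rewrite Normc.normcM normcN c1 mul1r normc_continuant_le.
exact: (ell2_bounded_shift _ (ell2_bounded_forcing _)).
Qed.
End sign.
End bounded_operators.

Section resolvent.
Variable R : realType.
Local Notation ell2 := (ell2 R).
Variables (c : sign_seq R) (n : nat).
Hypotheses (n0 : (0 < n)%N) (pc : forall m, c (m + n%:Z) = c m).
Hypothesis dc : forall m, \prod_(i < n) c (m + i%:Z) = 1.

Lemma sign_seq_sqr m : c m * c m = 1.
Proof. by case: (sign_seqP c m) => ->; rewrite ?mulrNN mulr1. Qed.

Lemma sign_seq_normc m : Normc.normc (c m) = 1.
Proof. by case: (sign_seqP c m) => ->; rewrite ?normcN Normc.normc1. Qed.

Variable z : R[i].
Let t := discriminant z c n 0.
Let Q (u : int -> R[i]) m := u (m + n%:Z) + u (m - n%:Z) - t * u m.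
Let P (u : int -> R[i]) m := period_rem z c u n m.
Let D (u : int -> R[i]) m := hop_fun c u m - z * u m.

Lemma hop_left_factor u m : P (D u) m = Q u m.
Proof.
by rewrite /P -(period_remE n0 pc _ dc (u := u))// => m'; rewrite /D /hop_fun; ring.
Qed.

(* Every sequence lies in the range of [hop_fun c - z], so commuting with the
   shift turns the left factorization into a right one. *)
Lemma hop_right_factor u m : D (P u) m = Q u m.
Proof.
have [w [_ _ hw]] := recurrence_solution z u 0 0 sign_seq_sqr.
have uE : u = D w by apply/funext => k; rewrite /D /hop_fun hw; ring.
have PE : P u = Q w by apply/funext => k; rewrite uE hop_left_factor.
rewrite PE uE /D /Q /hop_fun pc.
have -> : c (m - n%:Z) = c m by rewrite -pc subrK.
have e1 : m - 1 + n%:Z = m + n%:Z - 1 by ring.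
have e2 : m - 1 - n%:Z = m - n%:Z - 1 by ring.
have e3 : m + 1 + n%:Z = m + n%:Z + 1 by ring.
have e4 : m + 1 - n%:Z = m - n%:Z + 1 by ring.
rewrite e1 e2 e3 e4; ring.
Qed.

Variable mu : R[i].
Hypotheses (mu0 : mu != 0) (mu1 : Normc.normc mu < 1) (tE : t = mu + mu^-1).
Let G s (phi : ell2) := phi - mu *: ell2_shift s phi.

(** With [S] the shift by [n], this is [(1 - mu S)(1 - mu S^-1) = - mu (S + S^-1 - t)], from
    [t = mu + mu^-1]. *)
Lemma ell2_period_factor (phi : ell2) m :
  (G n%:Z (G (- n%:Z) phi)) m = - mu * Q phi m.
Proof.
rewrite -[LHS]/(phi m - mu * phi (m - n%:Z) -
  mu * (phi (m + n%:Z) - mu * phi (m + n%:Z - n%:Z))) addrK /Q tE.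
by field.
Qed.

(** For [|mu| < 1] both factors of [- mu Q] are invertible. Then [P D = Q] with [P] bounded gives a
    lower bound for [D], and [D P = Q] makes [D] surjective. *)
Lemma hop_resolvent : resolvent_set (hop c) z.
Proof.
have r0 := normc_ge0 mu.
have [C C0 hC] := ell2_bounded_period_rem z sign_seq_normc n.
have k0 : 0 < (1 - Normc.normc mu) ^+ 2 by rewrite exprn_gt0// subr_gt0.
(* [Num.sqrt C] bounds [P], each factor costs [1 - |mu|], and [|mu| < 1] absorbs the scalar
   [- mu]. *)
pose M := Num.sqrt C / (1 - Normc.normc mu) ^+ 2.
have DE (phi : ell2) : ell2_fun (hop c phi - z *: phi) = D phi by [].
apply: (@resolvent_setI _ _ _ _ (M%:C)%C).
- by rewrite ler0c divr_ge0 ?sqrtr_ge0// ltW.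
- move=> phi; rewrite !ell2_normE -rmorphM /= lecR /M mulrAC ler_pdivlMr// mulrC.
  have := neumann_bounded_below n%:Z mu (G (- n%:Z) phi).
  have := neumann_bounded_below (- n%:Z) mu phi.
  rewrite -/(G _ _) -/(G _ _) => h1 h2.
  have h3 : (1 - Normc.normc mu) ^+ 2 * ell2_rnorm phi <=
      ell2_rnorm (G n%:Z (G (- n%:Z) phi)).
    apply: le_trans h2; rewrite expr2 -mulrA ler_wpM2l// subr_ge0 ltW//.
  apply: le_trans h3 _.
  rewrite -ler_sqr ?nnegrE ?mulr_ge0 ?sqrtr_ge0 ?ell2_rnorm_ge0//.
  rewrite exprMn (sqr_sqrtr C0) -lee_fin [(C * _)%:E]EFinM -!sqr_ell2_rnorm DE.
  apply: le_trans (hC _).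
  have -> : ell2_fun (G n%:Z (G (- n%:Z) phi)) = (- mu) *: (P (D phi)).
    by apply/funext => m; rewrite ell2_period_factor -hop_left_factor.
  rewrite sqr_sumZ normcN gee_pMl ?sqr_sum_ge0 ?lee_fin ?expr_le1 ?(ltW mu1)//.
- move=> psi.
  have [phi1 h1] := neumann_surjective n%:Z (- mu *: psi) mu1.
  have [phi h2] := neumann_surjective (- n%:Z) phi1 mu1.
  have Ps : P phi \in square_summable.
    rewrite square_summableE; apply: le_lt_trans (hC _) _.
    by rewrite sqr_ell2_rnorm -EFinM ltry.
  exists (Ell2 Ps); apply: val_inj; apply/funext => m.
  rewrite -[LHS]/(D (P phi) m) hop_right_factor.
  apply: (@mulfI _ (- mu)); first by rewrite oppr_eq0.
  by rewrite -ell2_period_factor /G h2 h1.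
Qed.

End resolvent.

(** The solutions of [mu + mu^-1 = t] form a pair [mu], [mu^-1]; off the unit circle one of them has
    modulus below 1, and [hop_resolvent] contradicts [z] being in the spectrum. *)
Lemma spectrum_discriminant (R : realType) (c : sign_seq R) n (z : R[i]) :
  (0 < n)%N -> (forall m, c (m + n%:Z) = c m) ->
  (forall m, \prod_(i < n) c (m + i%:Z) = 1) -> spectrum (hop c) z ->
  exists2 mu : R[i], `|mu| = 1 & discriminant z c n 0 = mu + mu^-1.
Proof.
move=> n0 pc dc zs; set t := discriminant z c n 0.
have [mu mu2] : exists mu : R[i], mu * (t - mu) = 1.
  have [|mu] := closed_rootP ('X^2 - t *: 'X + 1%:P : {poly R[i]}) _.
    rewrite -addrA size_polyDl size_polyXn//.
    rewrite (leq_ltn_trans (size_polyD _ _))// gtn_max size_poly1 size_polyN.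
    by rewrite (leq_ltn_trans (size_scale_leq _ _))// size_polyX.
  rewrite /root !hornerE => /eqP h; exists mu.
  by apply/eqP; rewrite -subr_eq0 -oppr_eq0 -h; apply/eqP; ring.
have mu0 : mu != 0.
  by apply: contra_eq_neq mu2 => ->; rewrite mul0r eq_sym oner_neq0.
have tE : t = mu + mu^-1.
  by rewrite -(subrK mu t) -[t - mu](mulKf mu0) mu2 mulr1 addrC.
exists mu => //; rewrite normr_normc.
have [lt1|gt1|-> //] := ltgtP (Normc.normc mu) 1; case: zs.
  exact: (hop_resolvent n0 pc dc mu0 lt1).
apply: (hop_resolvent n0 pc dc (mu := mu^-1)).
- by rewrite invr_eq0.
- by rewrite Normc.normcV invf_lt1// (lt_trans ltr01).
- by rewrite invrK addrC.
Qed.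

(** * Bounded solutions and the inverse images *)

Section weyl.
Variable R : realType.
Local Notation ell2 := (ell2 R).
Implicit Types (u : int -> R[i]).

Lemma sqr_sum_finite_support u (B : R) (s : seq int) :
  (forall m, Normc.normc (u m) <= B) -> (forall m, m \notin s -> u m = 0) ->
  (sqr_sum u <= ((size s)%:R * B ^+ 2)%:E)%E.
Proof.
move=> uB us.
have -> : sqr_sum u = (\sum_(m <- undup s) ((Normc.normc (u m)) ^+ 2)%:E)%E.
  rewrite (fsbig_seq _ _ (undup_uniq s)) -esum_fset; last 2 first.
  - exact: finite_seq.
  - by move=> m _; rewrite lee_fin sqr_ge0.
  rewrite [RHS]esum_mkcond; apply: eq_esum => m _; case: ifPn => //.
  rewrite notin_setE /= mem_undup => /negP/us ->.
  by rewrite Normc.normc0 expr0n.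
rewrite sumEFin lee_fin.
apply: (@le_trans _ _ (\sum_(m <- undup s) B ^+ 2)).
  apply: ler_sum => m _; rewrite ler_sqr ?nnegrE ?normc_ge0//.
  exact: le_trans (normc_ge0 _) (uB m).
rewrite big_const_seq count_predT iter_addr_0 -[leLHS]mulr_natl ler_wpM2r ?sqr_ge0//.
by rewrite ler_nat size_undup.
Qed.

(** Truncations of [u] solve the equation up to an error of norm bounded independently of [N]. A
    bounded resolvent would bound the truncations, put [u] in [ell2], and make it an eigenvector,
    which is impossible. *)
Lemma hop_spectrum (c : sign_seq R) (z : R[i]) u (M : R) m0 :
  (forall m, Normc.normc (u m) <= M) -> u m0 != 0 ->
  (forall m, hop_fun c u m = z * u m) -> spectrum (hop c) z.
Proof.
move=> uM um0 uz [S [Sc SK _]].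
have /linear_bounded_continuous/linear_boundedP/pinfty_ex_gt0[r r0 hr] := Sc.
have [k kE] : exists k, r = (k%:C)%C by apply/complex_realP; exact: gtr0_real.
have k0 : 0 <= k by rewrite -ler0c -kE ltW.
have hk (phi : ell2) : ell2_rnorm phi <= k * ell2_rnorm (hop c phi - z *: phi).
  have := hr (hop c phi - z *: phi).
  by rewrite SK kE !ell2_normE -rmorphM /= lecR.
have M0 : 0 <= M by apply: le_trans (uM 0); exact: normc_ge0.
pose cut N m := if (`|m| <= N)%N then u m else 0.
have cutM N m : Normc.normc (cut N m) <= M.
  by rewrite /cut; case: ifP => // _; rewrite Normc.normc0.
have cutP N : cut N \in square_summable.
  rewrite square_summableE.
  pose s := [seq i%:Z | i <- iota 0 N.+1] ++ [seq - i%:Z | i <- iota 0 N.+1].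
  apply: le_lt_trans (sqr_sum_finite_support (s := s) (cutM N) _) (ltry _).
  move=> m; rewrite /cut mem_cat; case: leqP => // mN /negP; case.
  case: m mN => m mN; apply/orP; [left|right]; apply/mapP.
    by exists m => //; rewrite mem_iota; lia.
  by exists m.+1; [rewrite mem_iota; lia|lia].
pose a N := Ell2 (cutP N).
pose B := 2 * M + Normc.normc z * M.
(* The error lives on the four sites next to the cuts, with entries at most [B]. *)
have aB N : ell2_rnorm (hop c (a N) - z *: a N) <= 2 * B.
  have B0 : 0 <= B by rewrite addr_ge0 ?mulr_ge0 ?normc_ge0.
  rewrite -ler_sqr ?nnegrE ?mulr_ge0 ?ell2_rnorm_ge0//.
  rewrite -lee_fin -sqr_ell2_rnorm exprMn -[2 ^+ 2]natrX.
  apply: (sqr_sum_finite_support (s := [:: N%:Z; N.+1%:Z; - N%:Z; - N.+1%:Z])).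
    move=> m; rewrite -[X in Normc.normc X]/(
      c m * cut N (m - 1) + cut N (m + 1) - z * cut N m).
    apply: le_trans (le_normcD _ _) _; rewrite normcN Normc.normcM lerD//.
      apply: le_trans (le_normcD _ _) _; rewrite Normc.normcM sign_seq_normc mul1r.
      by rewrite mulr_natl mulr2n lerD.
    by rewrite ler_wpM2l ?normc_ge0.
  move=> m; rewrite !inE !negb_or => /and4P[h1 h2 h3 h4].
  rewrite -[LHS]/(c m * cut N (m - 1) + cut N (m + 1) - z * cut N m).
  have [mN|mN] : (`|m| < N \/ N.+1 < `|m|)%N by lia.
    rewrite /cut !ifT; try lia.
    by have := uz m; rewrite /hop_fun => ->; rewrite subrr.
  by rewrite /cut !ifF; [rewrite !mulr0 addr0 subr0|lia..].
have us : u \in square_summable.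
  apply: (@ell2_limit R a u (k * (2 * B))) => [N|m|m].
  - by apply: le_trans (hk _) _; rewrite ler_wpM2l.
  - apply: cvg_near_cst; near=> N.
    rewrite -[a N m]/(cut N m) /cut ifT//; near: N; exact: nbhs_infty_ge.
  - apply: cvg_near_cst; near=> N.
    rewrite -[a N m]/(cut N m) /cut ifT//; near: N; exact: nbhs_infty_ge.
have D0 : hop c (Ell2 us) - z *: Ell2 us = 0.
  apply: val_inj; apply/funext => m.
  by rewrite -[LHS]/(hop_fun c u m - z * u m) uz subrr.
have := SK (Ell2 us); rewrite D0 linear0 => /(congr1 (fun phi : ell2 => phi m0)) /=.
by move=> h; case/eqP: um0; rewrite -h.
Unshelve. all: by end_near. Qed.

End weyl.

Section bloch.
Variable R : realType.
Implicit Types (z w : R[i]) (k : int -> R[i]).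

(** Bounded solutions stand in for points of the spectrum because they can be lifted block by
    block. *)
Definition bloch z := exists2 c : sign_seq R, Defs.periodic c &
  exists u (M : R[i]) m0, [/\ forall m, `|u m| <= M, u m0 != 0 &
    forall m, hop_fun c u m = z * u m].

Lemma bloch_pi_infty z : bloch z -> pi_infty R z.
Proof.
move=> [c pc [u [M [m0 [uM um0 uz]]]]]; exists c => //.
have /complex_realP[B BE] : M \is Num.real.
  by rewrite ger0_real// (le_trans _ (uM 0)).
apply: (hop_spectrum (M := B) _ um0 uz) => m.
by rewrite -lecR -BE -normr_normc.
Qed.

(** The signs [s] are chosen so that [- g * s j * s (j - 1)] equals [c j]. The nonvanishing
    hypothesis gives [X != 0], which keeps the lifted solution nonzero. *)
Lemma bloch_palindrome k n z : (1 < n)%N -> (forall m, k m * k m = 1) ->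
  (forall i : nat, (1 < i < n)%N -> k (n.+1 - i)%N = k i) ->
  bloch (z * continuant z k 1 n) -> z * continuant z k 1 n != 0 -> bloch z.
Proof.
move=> n1 k1 kpal [c [p p0 pc] [v [M [m0 [vM vm0 vz]]]]] q0.
set X := continuant z k 1 n in vz q0.
pose g := \prod_(2 <= l < n.-1.+1) k l%:Z.
have g1 : g * g = 1 by rewrite /g -big_split big1 // => i _; exact: k1.
have c1 := sign_seq_sqr c.
pose f (j : int) (y : R[i]) := - g * c (j + 1) * y.
have fK j : cancel (f j) (f j).
  move=> y; rewrite /f -[RHS]mul1r -g1 -[RHS]mulr1 -(c1 (j + 1)); ring.
have [s s0 sS] := int_recursion 1 fK.
have s1 j : s j * s j = 1.
  rewrite (shift_invariant_cst (f := fun j => s j * s j)); last first.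
    move=> m; rewrite sS /f -[RHS]mul1r -g1 -[RHS]mulr1 -(c1 (m + 1)); ring.
  by rewrite s0 mulr1.
(* Over one period of [c], [s] is multiplied by a constant sign, hence the doubled period. *)
have sp j : s (j + (p + p)%N%:Z) = s j.
  pose r j := s (j + p%:Z) * s j.
  have rE i : r i = r 0.
    apply: shift_invariant_cst => m; rewrite /r.
    have -> : m + 1 + p%:Z = m + p%:Z + 1 by ring.
    rewrite !sS /f.
    have -> : m + p%:Z + 1 = m + 1 + p%:Z by ring.
    rewrite pc -[RHS]mul1r -g1 -[RHS]mulr1 -(c1 (m + 1)); ring.
  have sr i : s (i + p%:Z) = r 0 * s i by rewrite -(rE i) /r -mulrA s1 mulr1.
  have rr : r j * r j = 1 by rewrite /r mulrACA !s1 mulr1.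
  by rewrite PoszD addrA !sr -(rE j) mulrA rr mul1r.
have [|u [uX uz [a [b [d uabd]]]]] :=
  palindrome_lift (x := z) kpal n1 (s := s) (v := v).
  move=> j; rewrite -/X -vz /hop_fun -/g.
  have -> : s j = - g * c j * s (j - 1) by rewrite -{1}(subrK 1 j) sS /f subrK.
  have := s1 (j - 1); move: (s (j - 1)) => y y1.
  rewrite -[in RHS](mul1r (c j)) -[in RHS]g1 -[in RHS](mulr1 (c j)).
  by rewrite -[in RHS]y1; ring.
have ilP m : interleave k n s m = 1 \/ interleave k n s m = -1.
  have : interleave k n s m ^+ 2 == 1.
    by rewrite /interleave; case: `|_|%N => [|[|i]]; rewrite ?sqrrN expr2 ?s1 ?k1.
  by rewrite sqrf_eq1 => /orP[] /eqP; [left|right].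
exists (SignSeq ilP).
  exists (n * (p + p))%N; first by rewrite muln_gt0 addn_gt0 p0 (ltnW n1).
  move=> m; rewrite /= /interleave.
  have -> : m + (n * (p + p))%N%:Z = (p + p)%N%:Z * n%:Z + m by lia.
  rewrite divzMDl; last by lia.
  by rewrite modzMDl [_ + (_ %/ _)%Z]addrC sp.
exists u, (\sum_(i < n) (`|a i| + (`|b i| + `|d i|)) * M), (m0 * n%:Z).
split=> [m||m]; last exact: uz.
- have M0 : 0 <= M by apply: le_trans (vM 0).
  set j := (m %/ n)%Z; set i := `|(m %% n)%Z|%N.
  have iln : (i < n)%N.
    by rewrite /i; have := @ltz_pmod m n%:Z; have := @modz_ge0 m n%:Z; lia.
  have -> : m = j * n%:Z + i%:Z.
    by rewrite {1}(divz_eq m n) /i; have := @modz_ge0 m n%:Z; lia.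
  have ns : `|s j| = 1.
    have /eqP := s1 j; rewrite -expr2 sqrf_eq1 => /orP[] /eqP ->.
      exact: normr1.
    by rewrite normrN1.
  rewrite uabd//; apply: (@le_trans _ _ ((`|a i| + (`|b i| + `|d i|)) * M)).
    rewrite [leRHS]mulrDl; apply: le_trans (ler_normD _ _) _; rewrite !normrM lerD//.
      by rewrite ler_wpM2l.
    apply: ler_pM => //; apply: le_trans (ler_normD _ _) _.
    by rewrite normrM ns mulr1.
  rewrite (bigD1 (Ordinal iln))//= lerDl sumr_ge0// => l _.
  by rewrite mulr_ge0// !addr_ge0.
- rewrite uX mulf_neq0//; apply: contra_neq q0 => X0.
  by rewrite /X X0 mulr0.
Qed.

(** For [c = 1] the plane wave [mu ^ m] with [|mu| = 1] has eigenvalue [mu + mu^-1]. Negative values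
    are the ones reached later through powers equal to -1. *)
Lemma bloch_segment (r : R) : 0 <= r <= 1 -> bloch (- r%:C%C).
Proof.
move=> /andP[r0 r1].
have q0 : 0 <= 1 - (r / 2) ^+ 2 by nra.
pose y := Num.sqrt (1 - (r / 2) ^+ 2).
have yE : y ^+ 2 = 1 - (r / 2) ^+ 2 by rewrite sqr_sqrtr.
pose mu : R[i] := Complex (- r / 2) y.
pose mu' : R[i] := Complex (- r / 2) (- y).
have mm : mu * mu' = 1.
  apply/eqP; rewrite eq_complex /=; apply/andP; split; apply/eqP; last by ring.
  rewrite (_ : _ - _ = (r / 2) ^+ 2 + y ^+ 2); last by field.
  by rewrite yE addrC subrK.
have mu0 : mu != 0.
  by apply: contra_eq_neq mm => ->; rewrite mul0r eq_sym oner_neq0.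
have muV : mu^-1 = mu' by rewrite -[mu'](mulKf mu0) mm mulr1.
have muD : mu + mu^-1 = - r%:C%C.
  by rewrite muV; apply/eqP; rewrite eq_complex /=; apply/andP; split; apply/eqP;
    [field|rewrite subrr oppr0].
have nmu : `|mu| = 1.
  rewrite normr_normc; congr (_%:C)%C; rewrite /= yE.
  by rewrite (_ : _ + _ = 1) ?sqrtr1//; field.
have nmuX m : `|mu ^ m| = 1.
  by case: m => m; rewrite ?NegzE -?exprnN ?normfV normrX nmu expr1n ?invr1.
exists (SignSeq (sign_seq_fun := fun=> 1) (fun=> or_introl erefl)).
  by exists 1%N.
exists (fun m => mu ^ m), 1, 0; split=> [m||m]; first by rewrite nmuX.
  by rewrite expr0z oner_neq0.
rewrite /hop_fun /= mul1r !expfzDr// -muD expr1z exprN1; ring.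
Qed.

(** The block of length 2 has [q(z) = z ^+ 2]; pull back [N] times. *)
Lemma bloch_root N z : z != 0 -> bloch (z ^+ (2 ^ N)) -> bloch z.
Proof.
elim: N z => [|N IH] z z0; first by rewrite expr1.
rewrite expnS exprM => /(IH _ (expf_neq0 _ z0)) bz2.
have E : z * continuant z (fun=> 1) 1 2 = z ^+ 2.
  by rewrite continuantSS continuant1 continuant0; ring.
apply: (@bloch_palindrome (fun=> 1) 2); rewrite ?E ?expf_neq0// => *.
by rewrite mulr1.
Qed.

(** The exponent [2 ^ N.+1] is even, so [w ^+ 2 = 1] is excluded, as [continuant_multiple]
    requires. *)
Lemma minus_one_root_near (u e : R[i]) : `|u| = 1 -> 0 < e ->
  exists N w, w ^+ (2 ^ N.+1) = -1 /\ `|u - w| < e.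
Proof.
move=> u1 e0; have eE : e = (complex.Re e)%:C%C by rewrite RRe_real// gtr0_real.
have e0' : 0 < complex.Re e by rewrite -ltcR -eE.
pose N := Num.bound (4 / complex.Re e ^+ 2).
have [w wN uw] := roots_of_minus_one_dense N.+1 u1.
exists N, w; split=> //.
rewrite -(@ltr_pXn2r _ 2) ?nnegrE ?(ltW e0)//.
rewrite -(@ltr_pM2r _ (2 ^+ N.+1)) ?exprn_gt0//.
apply: le_lt_trans uw _.
rewrite eE -(rmorph_nat (real_complex R) 4) -(rmorph_nat (real_complex R) 2).
rewrite -!rmorphXn -rmorphM /= ltcR.
rewrite mulrC -ltr_pdivrMr ?exprn_gt0//.
by rewrite natrXE natrX; apply: upper_nthrootP; rewrite /N leqnSn.
Qed.

(** For [w != 0], keep the modulus and replace the direction by a nearby root of -1: a power of the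
    new point falls on the segment of [bloch_segment]. *)
Lemma bloch_dense_disk w (e : R[i]) : `|w| < 1 -> 0 < e ->
  exists w', [/\ bloch w', w' != 0 & `|w - w'| < e].
Proof.
move=> w1 e0.
have [w0|w0] := eqVneq w 0.
  have eE : e = (complex.Re e)%:C%C by rewrite RRe_real// gtr0_real.
  have e0' : 0 < complex.Re e by rewrite -ltcR -eE.
  (* Near 0 a point of the segment serves directly; this [r] is below both 1 and [e]. *)
  pose r := complex.Re e / (1 + complex.Re e).
  have e1 : 0 < 1 + complex.Re e by rewrite addr_gt0.
  have r0 : 0 < r by rewrite divr_gt0.
  exists (- r%:C%C); split.
  - by apply: bloch_segment; rewrite ltW//= ler_pdivrMr// mul1r lerDr.
  - by rewrite oppr_eq0 gt_eqF// ltcR.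
  - rewrite w0 sub0r opprK ger0_norm ?ler0c ?(ltW r0)// eE ltcR.
    by rewrite ltr_pdivrMr// mulrDr mulr1 ltrDl mulr_gt0.
have nw0 : `|w| != 0 by rewrite normr_eq0.
have [|N [v [vN uv]]] := @minus_one_root_near (w / `|w|) e _ e0.
  by rewrite normrM normfV normr_id mulfV.
exists (`|w| * v).
have v0 : v != 0.
  apply: contra_eq_neq vN => ->.
  by rewrite expr0n expn_eq0/= eq_sym oppr_eq0 oner_neq0.
split; last 2 first.
- by rewrite mulf_neq0.
- rewrite -{1}[w](divfK nw0) mulrC -mulrBr normrM normr_id.
  by apply: le_lt_trans uv; rewrite ler_piMl// ltW.
apply: (@bloch_root N.+1); first by rewrite mulf_neq0.
rewrite exprMn vN mulrN1 normr_normc -rmorphXn /=; apply: bloch_segment.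
rewrite exprn_ge0 ?normc_ge0//= exprn_ile1 ?normc_ge0//.
by move: w1; rewrite normr_normc -[1]/((1 : R)%:C%C) ltcR => /ltW.
Qed.

End bloch.

(** * The interior of [Sigma_pi] *)

Section main.
Variable R : realType.
Implicit Types (z w : R[i]) (k : int -> R[i]).

(** Near a zero of [q] the values [q(y)] lie in the unit disk. Each is approximated within [d ^+ n]
    by a nonzero Bloch value [w], and [root_continuity] yields a preimage of [w] within [d] of
    [y]. *)
Lemma interior_palindrome_root k n z : (1 < n)%N -> (forall m, k m * k m = 1) ->
  (forall i : nat, (1 < i < n)%N -> k (n.+1 - i)%N = k i) ->
  continuant z k 1 n = 0 -> interior (Sigma_pi R) z.
Proof.
move=> n1 k1 kpal zn.
pose q := 'X * continuant 'X (polyC \o k) 1 n.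
have qE y : q.[y] = y * continuant y k 1 n.
  by rewrite /q hornerM hornerX horner_continuant.
have [qs qm] : size q = n.+1 /\ q \is monic.
  have [cs cm] : size (continuant 'X (polyC \o k) 1 n) = n /\
      continuant 'X (polyC \o k) 1 n \is monic.
    by case: (n) n1 => // l _; rewrite !size_continuant.
  by rewrite /q mulrC size_mulX ?monic_neq0// cs monicMr ?monicX.
have [|e e0 small] := @horner_small _ q z; first by rewrite qE zn mulr0.
apply/nbhs_ballP; exists e => //= y; rewrite /ball /= distrC => /small qy.
move=> B /nbhs_ballP[d /= d0 dB].
have n0 := ltnW n1.
have [w [bw w0 qw]] := bloch_dense_disk qy (exprn_gt0 n d0).
have [y' qy' yy'] := root_continuity qm qs n0 d0 qw.
exists y'; split; last by apply: dB; rewrite /ball /=.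
rewrite qE in qy'; apply: bloch_pi_infty.
by apply: (bloch_palindrome n1 k1 kpal); rewrite qy'.
Qed.

Lemma pi_infty_closure_interior z :
  pi_infty R z -> closure (interior (Sigma_pi R)) z.
Proof.
move=> [c [p p0 pc] zc] B /nbhs_ballP[e /= e0 eB].
have c1 := sign_seq_sqr c.
(* Doubling the period makes the product of the signs over it a square, hence 1. *)
pose n := (p + p)%N; have n0 : (0 < n)%N by rewrite addn_gt0 p0.
have nc m : c (m + n%:Z) = c m by rewrite /n PoszD addrA !pc.
have dc m : \prod_(i < n) c (m + i%:Z) = 1.
  rewrite /n big_split_ord /= -big_split big1// => i _ /=.
  rewrite -[RHS](c1 (m + i%:Z)); congr (_ * _).
  by rewrite PoszD addrCA [p%:Z + _]addrC pc.
have [mu mu1 tE] := spectrum_discriminant n0 nc dc zc.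
(* On the unit circle [mu + mu^-1] changes by at most twice the change of [mu]. *)
have en0 : 0 < e ^+ n / 2 by rewrite divr_gt0 ?exprn_gt0.
have [N [nu [nuN munu]]] := minus_one_root_near mu1 en0.
have nu1 : `|nu| = 1.
  apply/eqP; rewrite -(@pexpr_eq1 _ _ (2 ^ N.+1))// ?expn_gt0//.
  by rewrite -normrX nuN normrN1.
have nu0 : nu != 0 by rewrite -normr_eq0 nu1 oner_neq0.
have mu0 : mu != 0 by rewrite -normr_eq0 mu1 oner_neq0.
have [ts tm] := size_discriminant c 0 n0.
have tz : `|(discriminant 'X (polyC \o c) n 0).[z] - (nu + nu^-1)| < e ^+ n.
  rewrite horner_discriminant tE.
  have -> : mu + mu^-1 - (nu + nu^-1) = (mu - nu) + (nu - mu) * (mu^-1 * nu^-1).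
    by field; rewrite mu0 nu0.
  apply: le_lt_trans (ler_normD _ _) _.
  rewrite !normrM !normfV mu1 nu1 invr1 !mulr1 [`|nu - mu|]distrC.
  by rewrite -mulr2n -[ltLHS]mulr_natr -ltr_pdivlMr.
have [z' z't zz'] := root_continuity tm ts n0 e0 tz.
rewrite horner_discriminant in z't.
exists z'; split; last by apply: eB; rewrite /ball /=.
pose M := (2 ^ N.+1 * n)%N.
have M0 : (0 < M)%N by rewrite muln_gt0 expn_gt0 n0.
have z'M : continuant z' c 1 M = 0.
  apply: (continuant_multiple n0 c1 nc dc nu0 nuN _ z't).
  apply/eqP => nu2; move/eqP: nuN; rewrite expnS exprM nu2 expr1n.
  by rewrite -subr_eq0 opprK -[1 + 1]/(2%:R) pnatr_eq0.
(* Reflecting the word gives a palindrome for [n = M.*2] that agrees with [c] up to site [M]. *)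
pose k (m : int) := if m <= M%:Z then c m else c ((M.*2).+1%:Z - m).
have k1 m : k m * k m = 1 by rewrite /k; case: ifP.
have kpal (i : nat) : (1 < i < M.*2)%N -> k ((M.*2).+1 - i)%N = k i.
  move=> iM; rewrite /k; case: (leqP i M) => h.
    by rewrite ifF ?ifT; [congr (c _)| |]; lia.
  by rewrite ifT ?ifF; [congr (c _)| |]; lia.
have zk : continuant z' k 1 M = 0.
  rewrite -[RHS]z'M; apply: eq_continuant => j hj.
  by rewrite /k ifT//; lia.
apply: (interior_palindrome_root _ k1 kpal); first by lia.
exact: (palindrome_root kpal erefl zk).
Qed.

End main.

Theorem theorem4p6 (R : realType) : Sigma_pi R = closure (interior (Sigma_pi R)).
Proof.
apply/seteqP; split.
  apply: subset_trans (@closed_closure _ (interior (Sigma_pi R))).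
  by apply: closureS; exact: pi_infty_closure_interior.
apply: subset_trans (closureS (@interior_subset _ _)) _.
exact: closed_closure.
Qed.
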